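(* Let $K$ be a field, let $S$ be a standard graded $K$-algebra, and let $M=\bigoplus_{n\ge0}M_n$ be a finitely generated graded $S$-module of Krull dimension $m\ge 1$ with Hilbert polynomial $P_M(t)=d_{M,m-1}t^{m-1}+\cdots+d_{M,1}t+d_{M,0}$. Then $$e(M)=e_0(M)=(m-1)!\,d_{M,m-1} = (m-1)!\, R_M(m),$$ where $e(M)$ is the multiplicity of $M$ and $R_M(m)=\operatorname{Res}_{z=m}\zeta_M(z)$.
   Context: A standard graded $K$-algebra is a finitely generated graded $K$-algebra $S=\bigoplus_{n\ge0}S_n$ with $S_0=K$ and $S=K[S_1]$. Put $H(M,n)=\dim_K M_n$. By the Hilbert-Serre theorem $\sum_{n\ge 0}H(M,n)t^n=\frac{h_M(t)}{(1-t)^m}$ with $h_M\in\mathbb Z[t]$, $h_M(1)\ne 0$; the multiplicity of $M$ is $e(M):=h_M(1)$. The Hilbert polynomial $P_M(t)\in\mathbb Q[t]$, of degree $m-1$, is the polynomial with $H(M,n)=P_M(n)$ for all $n\gg0$. The numbers $e_k(M)$, $0\le k\le m-1$, are defined by $P_M(t)=\sum_{k=0}^{m-1}(-1)^k e_k(M)\binom{t+m-1-k}{m-1-k}$. With $\zeta_M(z,w)=\sum_{n\ge 0}\frac{H(M,n)}{(n+w)^z}$ for real $w>0$, define $\zeta_M(z)=\lim_{w\searrow 0}(\zeta_M(z,w)-H(M,0)w^{-z})=\sum_{n=1}^{\infty}\frac{H(M,n)}{n^z}$; the series converges absolutely for $\operatorname{Re} z>m$ and extends to a meromorphic function on $\mathbb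 C$, whose residue is meant. *)

(* Defs.v *)
From HB Require Import structures.
From mathcomp Require Import all_boot all_order all_algebra.
From mathcomp Require Import all_classical all_reals all_analysis.
From mathcomp Require Import complex.

Set Implicit Arguments.
Unset Strict Implicit.
Unset Printing Implicit Defensive.

Import Order.TTheory GRing.Theory Num.Theory.
Import numFieldNormedType.Exports.

Local Open Scope classical_set_scope.
Local Open Scope ring_scope.

(* Since boolp makes every Prop-valued predicate boolean, quantifying over
   {pred V} below is quantifying over arbitrary subsets of V. *)

Section Grading.

(* V is the internal direct sum of the additive subgroups Vn 0, Vn 1, ... *)
Definition is_grading (V : zmodType) (Vn : nat -> {pred V}) : Prop :=
  [/\ forall n, GRing.zmod_closed (Vn n),
      forall x, exists (N : nat) (c : nat -> V),
        (forall n, c n \in Vn n) /\ x = \sum_(n < N) c n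
    & forall (N : nat) (c : nat -> V), (forall n, c n \in Vn n) ->
        \sum_(n < N) c n = 0 -> forall n, (n < N)%N -> c n = 0].

Variables (K : fieldType) (S : comAlgType K).

Definition generates_alg (G : {pred S}) : Prop :=
  forall A : {pred S}, GRing.subalg_closed A -> {subset G <= A} ->
  forall x, x \in A.

(* The K-linearity of each Sn n follows from the conditions on Sn 0 and on
   products. *)
Record standard_graded (Sn : nat -> {pred S}) : Prop := StandardGraded {
  sg_grading : is_grading Sn;
  sg_mul : forall i j x y, x \in Sn i -> y \in Sn j -> x * y \in Sn (i + j)%N;
  sg_deg0 : forall x, x \in Sn 0%N <-> exists c : K, x = c%:A;
  sg_deg1 : generates_alg (Sn 1%N);
  sg_fingen : exists s : seq S, generates_alg (mem s) }.

Variable M : lmodType S.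

Record graded_module (Sn : nat -> {pred S}) (Mn : nat -> {pred M}) : Prop :=
  GradedModule {
    gm_grading : is_grading Mn;
    gm_act : forall i j x v,
      x \in Sn i -> v \in Mn j -> x *: v \in Mn (i + j)%N }.

Definition fin_gen_module : Prop :=
  exists (r : nat) (g : 'I_r -> M),
    forall v, exists a : 'I_r -> S, v = \sum_(i < r) a i *: g i.

(* K acts on M through K -> S, c |-> c%:A. *)
Definition has_dim (A : {pred M}) (d : nat) : Prop :=
  exists b : 'I_d -> M, (forall i, b i \in A) /\
    forall v, v \in A ->
      exists! c : {ffun 'I_d -> K}, v = \sum_(i < d) (c i)%:A *: b i.

(* H(M, n) = dim_K M_n; the default value 0 is irrelevant, since M_n is finite
   dimensional when M is finitely generated. *)
Definition hilbert_fun (Mn : nat -> {pred M}) (n : nat) : nat :=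
  xget 0%N [set d | has_dim (Mn n) d].

(* idealr_closed includes properness. *)
Definition prime_over_ann (p : {pred S}) : Prop :=
  [/\ idealr_closed p, prime_idealr_closed p
    & forall x, (forall v : M, x *: v = 0) -> x \in p].

Definition prime_chain (l : nat) (p : nat -> {pred S}) : Prop :=
  (forall i, (i <= l)%N -> prime_over_ann (p i)) /\
  (forall i, (i < l)%N ->
     {subset p i <= p i.+1} /\ exists2 x, x \in p i.+1 & x \notin p i).

(* dim M = dim (S / Ann M) *)
Definition krull_dim (m : nat) : Prop :=
  (exists p, prime_chain m p) /\
  (forall l p, prime_chain l p -> (l <= m)%N).

End Grading.

Arguments fin_gen_module {K S} M.
Arguments krull_dim {K S} M m.

Section Hilbert.

Variables (H : nat -> nat) (m : nat).

(* (1 - t)^m * \sum_n H(n) t^n = h(t) in Z[[t]], compared coefficientwise. *)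
Definition hilbert_numerator (h : {poly int}) : Prop :=
  h.[1] != 0 /\
  forall n, h`_n = \sum_(i < n.+1) ((1 - 'X) ^+ m)`_i * (H (n - i)%N)%:Z.

Definition multiplicity : int :=
  (xget (0 : {poly int}) [set h | hilbert_numerator h]).[1].

Definition hilbert_poly (P : {poly rat}) : Prop :=
  size P = m /\ \forall n \near \oo, (H n)%:R = P.[n%:R].

(* the polynomial binomial(t + j, j) = (t + 1) ... (t + j) / j! *)
Definition binom_poly (j : nat) : {poly rat} :=
  (j`!%:R)^-1 *: \prod_(i < j) ('X + (i.+1%:R)%:P).

Definition hilbert_coefs (P : {poly rat}) (e : nat -> rat) : Prop :=
  P = \sum_(k < m) ((-1) ^+ k * e k) *: binom_poly (m.-1 - k)%N.

(* e_k; meaningful for k < m, where the value e k is determined by P. *)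
Definition hilbert_coef (P : {poly rat}) (k : nat) : rat :=
  xget 0 [set x | exists2 e : nat -> rat, hilbert_coefs P e & x = e k].

End Hilbert.

(* R[i] packed as a numClosedFieldType, so that the topology and norm of
   numFieldNormedType apply and derivable is complex differentiability. *)
Definition Cplx (R : realType) : numClosedFieldType := R[i]%C.

Section Zeta.

Variable R : realType.
Notation C := (Cplx R).

Definition cexp (z : C) : C :=
  (expR (complex.Re z) * cos (complex.Im z)
   +i* (expR (complex.Re z) * sin (complex.Im z)))%C.

(* n ^ (- z) = exp (- z log n), for n > 0 *)
Definition natpowN (n : nat) (z : C) : C := cexp (- z * (ln n%:R)%:C%C).

Definition dirichlet_series (H : nat -> nat) (z : C) : C :=
  limn (fun N : nat => \sum_(1 <= n < N) (H n)%:R * natpowN n z).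

Definition holomorphic_at (g : C -> C) (a : C) : Prop :=
  \forall z \near a, derivable g z 1.

(* f has a Laurent expansion at a with finite principal part
   \sum_(k < N) c k / (z - a) ^ (k + 1); the value of f at a is irrelevant. *)
Definition principal_part (f : C -> C) (a : C) (N : nat) (c : nat -> C) : Prop :=
  exists2 g : C -> C, holomorphic_at g a &
    \forall z \near a^', f z = \sum_(k < N) c k / (z - a) ^+ k.+1 + g z.

Definition meromorphic (f : C -> C) : Prop :=
  forall a, exists N c, principal_part f a N c.

Definition residue (f : C -> C) (a : C) : C :=
  xget 0 [set r | exists N c, principal_part f a N.+1 c /\ r = c 0%N].

Definition zeta_extension (H : nat -> nat) (m : nat) (Z : C -> C) : Prop :=
  meromorphic Z /\
  forall z : C, m%:R < complex.Re z -> Z z = dirichlet_series H z.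

End Zeta.

(* Main.v *)
(* Expand P = \sum_k c_k binom(t + m-1-k, m-1-k).  The differences of these
   binomials are binomials of lower degree, so the m-fold difference of H is
   eventually 0 and its (m-1)-fold difference is eventually c_0; hence (1-t)^m
   times the Hilbert series is a polynomial with value c_0 at 1, and comparing
   leading coefficients c_0 = (m-1)! d_{m-1}.
   For the residue, H(n)/n^(m-1) = d + O(1/n) with d = d_{m-1}, and telescoping
   n^-e bounds e \sum_n n^-(1+e) by 1 and 1 + e, so e zeta_M(m + e) = d + O(e)
   as e decreases to 0 along the reals.  This one-sided estimate already
   determines the principal part of a meromorphic function at m. *)
Require Import Defs.
From HB Require Import structures.
From mathcomp Require Import all_boot all_order all_algebra.
From mathcomp Require Import all_classical all_reals all_analysis.
From mathcomp Require Import complex ring lra.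

Set Implicit Arguments.
Unset Strict Implicit.
Unset Printing Implicit Defensive.

Import Order.TTheory GRing.Theory Num.Theory.
Import numFieldNormedType.Exports.

Local Open Scope classical_set_scope.
Local Open Scope ring_scope.

(** * Binomial polynomials as a basis of the rational polynomials *)

Lemma binom_prodE j :
  \prod_(i < j) ('X + (i.+1%:R)%:P) =
  \prod_(i < j) ('X - (- i.+1%:R)%:P) :> {poly rat}.
Proof. by apply: eq_bigr => i _; rewrite polyCN opprK. Qed.

Lemma size_binom_poly j : size (binom_poly j) = j.+1.
Proof.
rewrite size_scale ?invr_eq0 ?pnatr_eq0 -?lt0n ?fact_gt0 //.
by rewrite binom_prodE size_prod_XsubC /index_enum -enumT size_enum_ord.
Qed.

Lemma lead_coef_binom_poly j : (binom_poly j)`_j = (j`!%:R)^-1.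
Proof.
rewrite coefZ binom_prodE.
have /monicP := monic_prod_XsubC (index_enum 'I_j) xpredT
  (fun i : 'I_j => - i.+1%:R : rat).
rewrite lead_coefE size_prod_XsubC /index_enum -enumT size_enum_ord /= => ->.
by rewrite mulr1.
Qed.

Lemma horner_binom_poly j x :
  (binom_poly j).[x] = (j`!%:R)^-1 * \prod_(i < j) (x + i.+1%:R).
Proof.
rewrite /binom_poly hornerZ horner_prod; congr (_ * _).
by apply: eq_bigr => i _; rewrite hornerD hornerX hornerC.
Qed.

(** Pascal's rule: the two products share the factors x + 2, ..., x + j + 1, and the remaining
    factors x + j + 2 and x + 1 differ by j + 1. *)
Lemma binom_poly_diff j x :
  (binom_poly j.+1).[x + 1] - (binom_poly j.+1).[x] = (binom_poly j).[x + 1].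
Proof.
rewrite !horner_binom_poly big_ord_recr [in X in _ - X]big_ord_recl /=.
have -> : \prod_(i < j) (x + (bump 0 i).+1%:R) =
          \prod_(i < j) (x + 1 + i.+1%:R) :> rat.
  by apply: eq_bigr => i _; rewrite /bump /= add1n -addrA nat1r.
rewrite factS natrM invfM.
have nz : j.+1%:R != 0 :> rat by rewrite pnatr_eq0.
have nz' : j`!%:R != 0 :> rat by rewrite pnatr_eq0 -lt0n fact_gt0.
move: nz nz'; rewrite -[j.+1%:R]natr1; move: (\prod_(_ < _) _) (_%:R) (_%:R).
by move=> p a b na nb; field; rewrite na nb.
Qed.

Lemma binom_poly_span m (Q : {poly rat}) : (size Q <= m)%N ->
  exists c : nat -> rat, Q = \sum_(k < m) c k *: binom_poly (m.-1 - k)%N.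
Proof.
elim: m Q => [|m IH] Q.
  by rewrite leqn0 size_poly_eq0 => /eqP->; exists (fun=> 0); rewrite big_ord0.
(* [binom_poly m] has leading coefficient 1 / m!, so subtracting [a] times it cancels the degree [m]
   term. *)
move=> sQ; set a := m`!%:R * Q`_m.
have sQ' : (size (Q - a *: binom_poly m)%R <= m)%N.
  apply/leq_sizeP => i; rewrite coefB coefZ leq_eqVlt => /orP[/eqP<-|lt_mi].
    rewrite lead_coef_binom_poly /a mulrAC mulfV ?mul1r ?subrr //.
  by rewrite !nth_default ?mulr0 ?subrr // (leq_trans _ lt_mi) ?size_binom_poly.
have [c Qc] := IH _ sQ'.
exists (fun k => if k is k'.+1 then c k' else a).
rewrite big_ord_recl /= subn0 -[LHS](subrK (a *: binom_poly m)) addrC Qc.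
congr (_ + _); apply: eq_bigr => -[i lt_im] _ /=.
by rewrite /bump /= add1n subnS predn_sub.
Qed.

Lemma coef_binom_poly_sum m (c : nat -> rat) : (0 < m)%N ->
  (\sum_(k < m) c k *: binom_poly (m.-1 - k)%N)`_m.-1 = c 0%N / m.-1`!%:R.
Proof.
case: m => // m _; rewrite coef_sum big_ord_recl /= subn0 coefZ.
rewrite lead_coef_binom_poly big1 ?addr0 // => i _.
rewrite coefZ [_`_m]nth_default ?mulr0 // size_binom_poly.
by rewrite /= /bump add1n ltn_subrL (leq_ltn_trans _ (ltn_ord i)).
Qed.

(** Only the term k = 0 reaches degree m - 1, so the leading coefficient of [P] forces the same
    value at 0 on every admissible [e]; the sign there is 1. *)
Lemma hilbert_coef0 m (P : {poly rat}) (c : nat -> rat) : (0 < m)%N ->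
  P = \sum_(k < m) c k *: binom_poly (m.-1 - k)%N -> hilbert_coef m P 0 = c 0%N.
Proof.
move=> m0 Pc; rewrite /hilbert_coef; case: xgetP => [x _ [e He ->]|].
  have fN0 : m.-1`!%:R != 0 :> rat by rewrite pnatr_eq0 -lt0n fact_gt0.
  apply: (divIf fN0); rewrite -(coef_binom_poly_sum c) // -Pc He.
  by rewrite (coef_binom_poly_sum (fun k => (-1) ^+ k * e k)) // expr0 mul1r.
move=> /(_ (c 0%N)) []; exists (fun k => (-1) ^+ k * c k); last first.
  by rewrite expr0 mul1r.
by rewrite /hilbert_coefs Pc; apply: eq_bigr => i _; rewrite signrMK.
Qed.

(** * Iterated differences of the Hilbert function and the multiplicity *)

Section Numerator.
Variable H : nat -> nat.

(** The [k]-th backward difference of [H], extended by 0 to negative arguments; for k = m it is the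
    right-hand side in [hilbert_numerator]. *)
Definition numer_coef k n : int :=
  \sum_(i < n.+1) ((1 - 'X) ^+ k)`_i * (H (n - i)%N)%:Z.

(** Truncating the Hilbert series beyond degree [n] does not affect this coefficient, so identities
    of power series can be read off in a polynomial ring. *)
Lemma numer_coefE k n L : (n < L)%N ->
  numer_coef k n = ((1 - 'X) ^+ k * \poly_(i < L) (H i)%:Z)`_n.
Proof.
move=> nL; rewrite coefM; apply: eq_bigr => i _.
by rewrite coef_poly (leq_ltn_trans (leq_subr _ _) nL).
Qed.

Lemma numer_coef0 n : numer_coef 0 n = H n.
Proof. by rewrite (numer_coefE _ (ltnSn n)) expr0 mul1r coef_poly ltnSn. Qed.

Lemma numer_coefS0 k : numer_coef k.+1 0 = numer_coef k 0.
Proof.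
rewrite !(numer_coefE _ (ltnSn 0)) exprS -mulrA mulrBl mul1r.
by rewrite coefB coefXM subr0.
Qed.

Lemma numer_coefSS k n :
  numer_coef k.+1 n.+1 = numer_coef k n.+1 - numer_coef k n.
Proof.
rewrite !(numer_coefE _ (ltnSn n.+1)) (@numer_coefE _ _ n.+2) //.
by rewrite exprS -mulrA mulrBl mul1r coefB coefXM.
Qed.

Lemma sum_numer_coef k n :
  \sum_(i < n.+1) numer_coef k.+1 i = numer_coef k n.
Proof.
elim: n => [|n IH]; first by rewrite big_ord1 numer_coefS0.
by rewrite big_ord_recr IH /= numer_coefSS addrC subrK.
Qed.

Variables (m n0 : nat) (c : nat -> rat).
Hypothesis Hc : forall n, (n0 <= n)%N ->
  (H n)%:R = (\sum_(k < m) c k *: binom_poly (m.-1 - k)%N).[n%:R].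

(** By Pascal's rule each difference lowers every binomial by one degree and kills the constant one.
    It also looks back one step, hence the threshold n0 + k. *)
Lemma numer_coef_ev k n : (n0 + k <= n)%N -> (k <= m)%N ->
  (numer_coef k n)%:~R =
  \sum_(i < (m - k)%N) c i * (binom_poly ((m - k).-1 - i)%N).[n%:R].
Proof.
elim: k n => [|k IH] n.
  rewrite addn0 => /Hc + _; rewrite numer_coef0 subn0 horner_sum => Hn.
  by rewrite -pmulrn Hn; apply: eq_bigr => i _; rewrite hornerZ.
case: n => [|n]; rewrite addnS // ltnS => le_n lt_km.
rewrite numer_coefSS rmorphB /= !IH ?(leqW le_n) ?(ltnW lt_km) // subnS.
case: (m - k)%N (subn_gt0 k m) => [|d] /=; rewrite lt_km // => _.
(* The last summand is a multiple of [binom_poly 0] = 1, so it cancels in the difference. *)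
rewrite !big_ord_recr /= subnn !horner_binom_poly !big_ord0.
rewrite opprD addrACA subrr addr0 -sumrB; apply: eq_bigr => i _.
rewrite -mulrBr -(natr1 n).
have -> : (d - i)%N = (d.-1 - i).+1.
  by case: d i => [[]//|d] i /=; rewrite subSn // -ltnS.
by rewrite binom_poly_diff.
Qed.

Lemma multiplicity_eq : (0 < m)%N -> c 0%N != 0 ->
  (multiplicity H m)%:~R = c 0%N.
Proof.
move=> m0 c0; set N := (n0 + m)%N.
have ev0 n : (N <= n)%N -> numer_coef m n = 0.
  move=> le_n; apply: (@intr_inj rat).
  by rewrite (numer_coef_ev le_n) // subnn big_ord0.
(* The sum telescopes to the (m-1)-fold difference at [N], where only the constant binomial with
   coefficient [c 0] is left. *)
have sum_c : (\sum_(n < N.+1) numer_coef m n)%:~R = c 0%N.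
  rewrite -{1}(prednK m0) sum_numer_coef numer_coef_ev ?leq_pred //; last first.
    by rewrite leq_add2l leq_pred.
  have -> : (m - m.-1 = 1)%N by rewrite -{1}(prednK m0) subSnn.
  rewrite big_ord1 /= horner_binom_poly big_ord0.
  by rewrite mulr1.
set h := \poly_(n < N.+1) numer_coef m n.
have hE n : h`_n = numer_coef m n.
  by rewrite coef_poly; case: ltnP => // /ltnW /ev0.
have h1 : h.[1] = \sum_(n < N.+1) numer_coef m n.
  by rewrite horner_poly; apply: eq_bigr => i _; rewrite expr1n mulr1.
have hP : hilbert_numerator H m h.
  by split=> //; rewrite h1 -(intr_eq0 rat) sum_c.
rewrite /multiplicity; case: xgetP => [h' _ [_ h'E]|/(_ h)//].
(* [hilbert_numerator] prescribes every coefficient, so the chosen numerator is [h]. *)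
suff -> : h' = h by rewrite h1.
by apply/polyP => n; rewrite h'E hE.
Qed.
End Numerator.

(** * Principal parts determined by a one-sided estimate *)

Lemma poly_eq0_of_small (F : numFieldType) N (r : {poly F}) (B delta : F) :
  0 < delta -> 0 <= B -> (size r <= N)%N ->
  (forall t, 0 < t < delta -> `|r.[t]| <= B * t ^+ N) -> r = 0.
Proof.
move=> d0; elim: N r B => [|N IH] r B B0.
  by rewrite leqn0 size_poly_eq0 => /eqP.
(* Write the polynomial as r X + c: the bound forces c = 0, and dividing by t then lowers both the
   size and the exponent in the bound. *)
elim/poly_ind: r => [//|r c _] sr small.
have {}sr : (size r <= N)%N.
  move: sr; rewrite size_MXaddC; case: ifP => // /andP[/eqP-> _].
  by rewrite size_poly0.
set A := \sum_(i < size r) `|r`_i|.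
have A0 : 0 <= A by apply: sumr_ge0.
have rA t : 0 < t <= 1 -> `|r.[t]| <= A.
  case/andP=> t0 t1; rewrite horner_coef (le_trans (ler_norm_sum _ _ _)) //.
  apply: ler_sum => i _; rewrite normrM normrX ler_piMr //.
  by rewrite exprn_ile1 // gtr0_norm // ltW.
have c0 : c = 0.
  apply/eqP; apply: contraT => c_neq0.
  have nc : 0 < `|c| by rewrite normr_gt0.
  (* The point t = 1/x lies below [delta], is at most 1, and makes (A + B) t < |c|, against the
     bound |c| <= (A + B) t. *)
  pose x := delta^-1 + 1 + (A + B) / `|c|.
  have y0 : 0 <= (A + B) / `|c| by rewrite divr_ge0 ?addr_ge0.
  have di0 : 0 < delta^-1 by rewrite invr_gt0.
  have x0 : 0 < x by rewrite ltr_pwDl // addr_gt0.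
  have tx : 0 < x^-1 by rewrite invr_gt0.
  have x1 : 1 <= x by rewrite /x addrAC lerDr addr_ge0 // ltW.
  have td : x^-1 < delta.
    by rewrite invf_plt ?posrE // /x -addrA ltrDl ltr_wpDr.
  have t1 : x^-1 <= 1 by rewrite invf_le1.
  have tc : (A + B) * x^-1 < `|c|.
    rewrite ltr_pdivrMr // -ltr_pdivrMl // mulrC.
    by rewrite /x ltrDr addr_gt0.
  have /small : 0 < x^-1 < delta by rewrite tx.
  rewrite hornerMXaddC => le1.
  suff : `|c| <= (A + B) * x^-1 by move=> /(lt_le_trans tc); rewrite ltxx.
  rewrite -[c](addKr (r.[x^-1] * x^-1)) (le_trans (ler_normD _ _)) //.
  rewrite normrN mulrDl lerD //.
    by rewrite normrM (gtr0_norm tx) ler_wpM2r ?(ltW tx) // rA // tx.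
  rewrite (le_trans le1) // ler_wpM2l // exprS ler_piMr ?(ltW tx) //.
  by rewrite exprn_ile1 // ltW.
rewrite c0 addr0 (IH r B) ?mul0r // => t /andP[t0 td].
have := small t; rewrite t0 td c0 addr0 hornerMX exprS normrM (gtr0_norm t0).
by rewrite mulrCA mulrC ler_pM2l //; apply.
Qed.

Section Residue.
Variable R : realType.
Notation C := (Cplx R).

Lemma holomorphic_at_bounded (g : C -> C) (a : C) : holomorphic_at g a ->
  exists2 B : C, 0 <= B & \forall z \near a, `|g z| <= B.
Proof.
move=> /nbhs_singleton /derivable1_diffP /differentiable_continuous cg.
exists (`|g a| + 1); first by rewrite addr_ge0.
have ltg : `|g a| < `|g a| + 1 by rewrite ltrDl.
by apply: filterS (cvgr_norm_lt _ cg _ ltg) => z /ltW.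
Qed.

(** In [C], 0 < t means that t is a positive real. On this ray t^N (t f(a+t) - d - t g(a+t)) is a
    polynomial in t of degree at most N that is O(t^(N+1)), hence zero; its coefficient at t^N is
    c_0 - d. *)
Lemma principal_part_coef0 (f : C -> C) (a : C) N (c : nat -> C) (d B : C) :
  principal_part f a N.+1 c -> 0 <= B ->
  (forall t, 0 < t -> `|t * f (a + t) - d| <= B * t) -> c 0%N = d.
Proof.
move=> [g /holomorphic_at_bounded[A A0 gA] fE] B0 fd.
have : \forall z \near a, z != a ->
    f z = \sum_(k < N.+1) c k / (z - a) ^+ k.+1 + g z /\ `|g z| <= A.
  by near=> z => za; split; [move: za; near: z|near: z].
rewrite nbhs0P => /nbhs_norm0P[delta /= delta0 near_a].
(* The polynomial lists these coefficients in reverse, since c_k / t^(k+1) becomes c_k t^(N-k). *)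
pose b k := c k - (if k == 0%N then d else 0).
pose r := \poly_(i < N.+1) b (N - i)%N.
suff r0 : r = 0.
  have := congr1 (fun p : {poly C} => p`_N) r0.
  by rewrite coef0 coef_poly ltnSn subnn => /eqP; rewrite subr_eq0 => /eqP.
apply: (@poly_eq0_of_small _ N.+1 r (A + B) delta) => //.
- exact: addr_ge0.
- exact: size_poly.
move=> t /andP[t0 td].
have tn0 : t != 0 by rewrite gt_eqF.
have [] := near_a t; rewrite /= ?(gtr0_norm t0) //.
  by rewrite -subr_eq0 addrAC subrr add0r.
rewrite addrAC subrr add0r => fat gat.
have -> : r.[t] = t ^+ N * ((t * f (a + t) - d) - t * g (a + t)).
  rewrite fat [t * (_ + _)]mulrDr [_ + _ - d - _]addrAC addrK horner_poly.
  have tE j : (j <= N)%N ->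
      t ^+ N * (t * (c j / t ^+ j.+1)) = c j * t ^+ (N - j).
    move=> le_jN; rewrite -{1}(subnK le_jN) exprD exprS.
    by field; rewrite tn0 expf_neq0.
  rewrite (reindex_inj rev_ord_inj) /= mulrBr !mulr_sumr.
  rewrite [in RHS](eq_bigr (fun j : 'I_N.+1 => c j * t ^+ (N - j))); last first.
    by move=> j _; rewrite tE // -ltnS.
  rewrite !big_ord_recl /= subSS subn0 subnn {1}/b eqxx mulrBl addrAC.
  rewrite [d * _]mulrC; congr (_ + _ - _); apply: eq_bigr => i _.
  by rewrite /bump /= add1n subSS /b subKn // subr0.
rewrite normrM normrX (gtr0_norm t0) exprSr mulrA [_ * t ^+ N]mulrC -mulrA.
rewrite ler_wpM2l ?exprn_ge0 ?(ltW t0) // (le_trans (ler_normB _ _)) //.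
rewrite [A + B]addrC mulrDl lerD //; first exact: fd.
by rewrite normrM (gtr0_norm t0) mulrC ler_wpM2r ?(ltW t0).
Unshelve. all: by end_near.
Qed.

Lemma residue_eq (f : C -> C) (a d B : C) : meromorphic f -> 0 <= B ->
  (forall t, 0 < t -> `|t * f (a + t) - d| <= B * t) -> residue f a = d.
Proof.
move=> mf B0 fd; rewrite /residue; case: xgetP => [r _ [N [c [pp ->]]]|no].
  exact: principal_part_coef0 pp B0 fd.
have [N [c [g hg fE]]] := mf a.
(* [residue] asks for a principal part with at least one term, so the given one, possibly empty, is
   padded by a zero. *)
pose c' k := if (k < N)%N then c k else 0.
case: (no (c' 0%N)); exists N, c'; split=> //; exists g => //.
apply: filterS fE => z ->; congr (_ + _).
rewrite big_ord_recr /= /c' ltnn mul0r addr0.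
by apply: eq_bigr => i _; rewrite ltn_ord.
Qed.

End Residue.

(** * Real Dirichlet series near s = 1 *)

Section RealZeta.
Variable R : realType.
Implicit Types (e d B : R) (a : nat -> R).

(* n ^ - s for n > 0; npow s 0 = 1 because ln 0 = 0. *)
Definition npow (s : R) (n : nat) : R := expR (- s * ln n%:R).

Lemma npow_gt0 s n : 0 < npow s n. Proof. exact: expR_gt0. Qed.

Lemma npow1 s : npow s 1 = 1.
Proof. by rewrite /npow ln1 mulr0 expR0. Qed.

Lemma npow_le1 s n : 0 <= s -> (0 < n)%N -> npow s n <= 1.
Proof.
move=> s0 n0.
by rewrite /npow expR_le1 mulNr oppr_le0 mulr_ge0 // ln_ge0 // ler1n.
Qed.

Lemma npow1D s n : (0 < n)%N -> npow (1 + s) n = npow s n / n%:R.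
Proof.
move=> n0; rewrite /npow opprD mulrDl mulN1r expRD expRN lnK ?posrE ?ltr0n //.
exact: mulrC.
Qed.

Lemma npow_natD k s n : (0 < n)%N -> npow (k%:R + s) n = npow s n / n%:R ^+ k.
Proof.
move=> n0; elim: k => [|k IH]; first by rewrite add0r divr1.
by rewrite -nat1r -addrA npow1D // IH exprSr invfM mulrA.
Qed.

(** Both bounds are ln (1 + x) <= x, at x = 1/n and at x = -1/(n+1). *)
Lemma ln_succ_bounds n : (0 < n)%N ->
  n.+1%:R^-1 <= @ln R n.+1%:R - @ln R n%:R <= n%:R^-1.
Proof.
move=> n0; have n0' : (0 : R) < n%:R by rewrite ltr0n.
have n1' : (0 : R) < n.+1%:R by rewrite ltr0n.
rewrite -ln_div ?posrE //; apply/andP; split; last first.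
  have -> : n.+1%:R / n%:R = 1 + n%:R^-1 :> R.
    by rewrite -natr1 mulrDl divff ?gt_eqF // mul1r.
  by rewrite le_ln1Dx // (@lt_trans _ _ 0) ?ltrN10 ?invr_gt0.
rewrite -invf_div lnV ?posrE ?divr_gt0 // lerNr.
have -> : n%:R / n.+1%:R = 1 + - n.+1%:R^-1 :> R.
  apply: (mulIf (lt0r_neq0 n1')).
  rewrite divfK ?lt0r_neq0 // mulrDl mulNr mulVf ?lt0r_neq0 //.
  by rewrite mul1r -natr1 addrK.
by rewrite le_ln1Dx // ltrN2 invf_lt1 // ltr1n.
Qed.

Lemma npow_diff_le e n : 0 < e -> (0 < n)%N ->
  npow e n - npow e n.+1 <= e * npow (1 + e) n.
Proof.
move=> e0 n0; have /andP[_ dle] := ln_succ_bounds n0.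
rewrite npow1D // lerBlDr -lerBlDl.
have -> : npow e n.+1 = npow e n * expR (- e * (ln n.+1%:R - ln n%:R)).
  by rewrite /npow -expRD -mulrDr addrC subrK.
rewrite mulrCA -[X in X - _]mulr1 -mulrBr ler_wpM2l ?(ltW (npow_gt0 _ _)) //.
apply: le_trans (expR_ge1Dx _); rewrite mulNr lerD2l lerN2.
by rewrite ler_wpM2l // ltW.
Qed.

Lemma npow_diff_ge e n : 0 < e -> (0 < n)%N ->
  e * npow (1 + e) n.+1 <= npow e n - npow e n.+1.
Proof.
move=> e0 n0; have /andP[dge _] := ln_succ_bounds n0.
rewrite npow1D // lerBrDr.
have -> : npow e n = npow e n.+1 * expR (e * (ln n.+1%:R - ln n%:R)).
  by rewrite /npow -expRD; congr expR; ring.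
rewrite mulrCA -[X in _ + X]mulr1 -mulrDr ler_wpM2l ?(ltW (npow_gt0 _ _)) //.
apply: le_trans (expR_ge1Dx _); rewrite addrC lerD2l.
by rewrite ler_wpM2l // ltW.
Qed.

Lemma zeta_sum_ge e N : 0 < e ->
  1 - npow e N.+1 <= e * \sum_(0 <= n < N) npow (1 + e) n.+1.
Proof.
move=> e0; elim: N => [|N IH]; first by rewrite npow1 subrr big_geq // mulr0.
rewrite big_nat_recr //= mulrDr.
by have := @npow_diff_le e N.+1 e0 isT; lra.
Qed.

Lemma zeta_sum_le e N : 0 < e ->
  e * \sum_(0 <= n < N) npow (1 + e) n.+1 <= 1 + e.
Proof.
move=> e0; case: N => [|N]; first by rewrite big_geq // mulr0; lra.
(* The telescoping bound [npow_diff_ge] covers the terms from 2 on; the term at 1 contributes the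
   extra e. *)
suff : e * \sum_(0 <= n < N.+1) npow (1 + e) n.+1 <= 1 + e - npow e N.+1.
  by have := npow_gt0 e N.+1; lra.
elim: N => [|N IH]; first by rewrite big_nat1 !npow1; lra.
rewrite big_nat_recr //= mulrDr.
by have := @npow_diff_ge e N.+1 e0 isT; lra.
Qed.

Lemma npow_cvg0 e : 0 < e -> npow e n.+1 @[n --> \oo] --> (0 : R).
Proof.
move=> e0.
have cy : e * ln n.+1%:R @[n --> \oo] --> (+oo : set_system R).
  apply/cvgryPge => A; near=> n.
  rewrite -ler_pdivrMl // -ler_expR lnK ?posrE ?ltr0n //.
  rewrite (@le_trans _ _ n%:R) // ?ler_nat //.
  by near: n; exact: nbhs_infty_ger.
rewrite /npow; under eq_fun do rewrite mulNr.
exact: (cvg_comp _ _ cy (@cvgr_expR R)).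
Unshelve. all: by end_near.
Qed.

(** Split a_n = d + (a_n - d). The constant part gives d up to |d| e by the two zeta bounds; the
    remainder is dominated by B n^-2, whose sum is at most 2 B uniformly in e. *)
Lemma dirichlet_pole a d B e : 0 < e ->
  (forall n, (0 < n)%N -> `|a n - d| <= B / n%:R) ->
  exists2 T : R,
    \sum_(1 <= n < N) a n * npow (1 + e) n @[N --> \oo] --> T &
    `|e * T - d| <= (`|d| + 2 * B) * e.
Proof.
move=> e0 aB.
have B0 : 0 <= B by have := aB 1%N isT; rewrite divr1; exact: le_trans.
pose w n := a n.+1 * npow (1 + e) n.+1.
have wE n : w n = d * npow (1 + e) n.+1 + (a n.+1 - d) * npow (1 + e) n.+1.
  by rewrite -mulrDl addrC subrK.
have errle n : `|(a n.+1 - d) * npow (1 + e) n.+1| <= B * npow (1 + 1) n.+1.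
  rewrite normrM (gtr0_norm (npow_gt0 _ _)).
  apply: le_trans (ler_wpM2r (ltW (npow_gt0 _ _)) (aB _ _)) _ => //.
  rewrite -mulrA ler_wpM2l // !npow1D // -[1](addr0 1) npow1D // addr0.
  rewrite {2}/npow oppr0 mul0r expR0 mulrA [_ * npow _ _]mulrC.
  by rewrite !ler_wpM2r ?invr_ge0 // npow_le1 // ltW.
have errsum N : \sum_(0 <= n < N) `|(a n.+1 - d) * npow (1 + e) n.+1| <= 2 * B.
  rewrite (le_trans (ler_sum _ (fun i _ => errle i))) // -mulr_sumr mulrC.
  (* The zeta bound at e = 1 gives 2 for the sum of n^-2. *)
  by rewrite ler_wpM2r // -[X in X <= _]mul1r zeta_sum_le.
have cw : cvgn (series w).
  apply: normed_cvg; rewrite -[X in cvgn X]/(series (fun n => `|w n|)).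
  apply: nondecreasing_is_cvgn.
    by apply/nondecreasing_seqP => n; rewrite /series /= big_nat_recr //= lerDl.
  exists (`|d| * ((1 + e) / e) + 2 * B) => _ [N _ <-].
  rewrite /series /=.
  apply: le_trans (lerD (ler_wpM2l (normr_ge0 d) _) (errsum N)); last first.
    by rewrite ler_pdivlMr // mulrC; exact: (zeta_sum_le N).
  rewrite mulr_sumr -big_split /=; apply: ler_sum => n _.
  rewrite wE (le_trans (ler_normD _ _)) // normrM.
  by rewrite (gtr0_norm (npow_gt0 _ _)).
exists (limn (series w)).
  rewrite -cvg_shiftS; under eq_fun do rewrite big_add1 /=.
  exact: cw.
have cl : `|e * series w N - d| @[N --> \oo] --> `|e * limn (series w) - d|.
  by apply: cvg_norm; apply: cvgB; [exact: cvgM (cvg_cst _) cw|exact: cvg_cst].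
(* The partial sums satisfy the bound up to the telescoping tail |d| (N+1)^-e, which vanishes in the
   limit. *)
have cr : (`|d| + 2 * B) * e + `|d| * npow e N.+1 @[N --> \oo] -->
    (`|d| + 2 * B) * e + `|d| * 0.
  by apply: cvgD; [exact: cvg_cst|exact: cvgM (cvg_cst _) (npow_cvg0 e0)].
rewrite mulr0 addr0 in cr.
apply: (ler_cvg_to cl cr); apply: nearW => N.
have -> : e * series w N - d =
    d * (e * (\sum_(0 <= n < N) npow (1 + e) n.+1) - 1) +
    e * \sum_(0 <= n < N) (a n.+1 - d) * npow (1 + e) n.+1.
  rewrite /series /= (eq_bigr _ (fun n _ => wE n)) big_split /= -mulr_sumr.
  by ring.
have lo := zeta_sum_ge N e0; have hi := zeta_sum_le N e0.
rewrite mulrDl addrAC -mulrDr (le_trans (ler_normD _ _)) // !normrM lerD //.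
  rewrite ler_wpM2l // ler_norml.
  by have := npow_gt0 e N.+1; lra.
rewrite (gtr0_norm e0) mulrC ler_wpM2r // ?(ltW e0) //.
exact: le_trans (ler_norm_sum _ _ _) (errsum N).
Qed.

End RealZeta.

(** * From the Hilbert polynomial to the pole of the zeta function *)

Lemma lead_coef_error (F : numFieldType) (h : nat -> F) (Q : {poly F}) m n0 :
  (size Q <= m.+1)%N -> (forall n, (n0 <= n)%N -> h n = Q.[n%:R]) ->
  exists B, forall n, (0 < n)%N -> `|h n / n%:R ^+ m - Q`_m| <= B / n%:R.
Proof.
move=> sQ hQ; pose x n := `|h n / n%:R ^+ m - Q`_m|.
have s0 : 0 <= \sum_(i < m) `|Q`_i| by apply: sumr_ge0.
have s1 : 0 <= \sum_(i < n0) x i * i%:R.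
  by apply: sumr_ge0 => i _; rewrite mulr_ge0 ?/x.
(* The first sum handles the lower-order terms of [Q] when n >= n0; the second contains x_n n for
   each of the finitely many n < n0. *)
exists (\sum_(i < m) `|Q`_i| + \sum_(i < n0) x i * i%:R) => n n_gt0.
have n0' : 0 < n%:R :> F by rewrite ltr0n.
rewrite ler_pdivlMr // -/(x n); case: (ltnP n n0) => [lt_n|le_n].
  rewrite ler_wpDl // (bigD1 (Ordinal lt_n)) //= lerDl.
  by apply: sumr_ge0 => i _; rewrite mulr_ge0 ?/x.
rewrite ler_wpDr // /x hQ // (horner_coef_wide _ sQ) big_ord_recr /=.
rewrite mulrDl mulfK ?expf_neq0 ?gt_eqF // addrK mulr_suml.
rewrite (le_trans (ler_wpM2r (ltW n0') (ler_norm_sum _ _ _))) // mulr_suml.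
apply: ler_sum => i _; rewrite !normrM normfV !normrX normr_nat -!mulrA.
rewrite ler_piMr // mulrCA ler_pdivrMl ?exprn_gt0 // mulr1 -exprSr.
by rewrite ler_weXn2l // ler1n.
Qed.

Section Zeta.
Variable R : realType.
Notation C := (Cplx R).

Lemma cvg_real_complex (u : nat -> R) (l : R) :
  u n @[n --> \oo] --> l -> ((u n)%:C%C : C) @[n --> \oo] --> (l%:C%C : C).
Proof.
move=> /cvgrPdist_lt ul; apply/cvgrPdist_lt => e e0.
have := e0; rewrite ltcE /= => /andP[/eqP e1 e2].
apply: filterS (ul _ e2) => n.
rewrite -rmorphB normc_def /= expr0n addr0 sqrtr_sqr ltcE /= => ->.
by rewrite e1 eqxx.
Qed.

Lemma natpowN_real n (x : R) : natpowN n (x%:C%C : C) = (npow x n)%:C%C.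
Proof.
rewrite /natpowN /cexp -rmorphN -rmorphM /= cos0 sin0 mulr1 mulr0.
by rewrite complexr0.
Qed.

(** Absorbing n^-m into the coefficients turns the series at m + 1 + t into a real one at 1 + t with
    coefficients H(n) / n^m, which tend to the coefficient of [Q] at m with error O(1/n). *)
Lemma dirichlet_series_pole (H : nat -> nat) (Q : {poly R}) m n0 :
  (size Q <= m.+1)%N -> (forall n, (n0 <= n)%N -> (H n)%:R = Q.[n%:R]) ->
  exists2 B : C, 0 <= B & forall t : C, 0 < t ->
    `|t * dirichlet_series H (m.+1%:R + t) - (Q`_m)%:C%C| <= B * t.
Proof.
move=> sQ hQ.
have [B aB] := @lead_coef_error _ (fun n => (H n)%:R) Q m n0 sQ hQ.
have B0 : 0 <= B by have := aB 1%N isT; rewrite divr1; exact: le_trans.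
set d := Q`_m in aB *.
exists ((`|d| + 2 * B)%:C%C : C) => [|t].
  by rewrite lecR addr_ge0 ?mulr_ge0.
(* Positivity in [C] makes the imaginary part zero. *)
rewrite ltcE; case: t => e t /= /andP[/eqP-> e0].
rewrite complexr0.
have [T cT eT] := dirichlet_pole e0 aB.
have -> : dirichlet_series H (m.+1%:R + e%:C%C) = T%:C%C :> C.
  rewrite /dirichlet_series; apply/cvg_lim; first exact: norm_hausdorff.
  have -> : m.+1%:R + e%:C%C = (m%:R + (1 + e))%:C%C :> C.
    by rewrite addrA natr1 rmorphD rmorph_nat.
  have -> : (fun N => \sum_(1 <= n < N)
                (H n)%:R * natpowN n (m%:R + (1 + e))%:C%C) =
      (fun N => (\sum_(1 <= n < N)
                (H n)%:R / n%:R ^+ m * npow (1 + e) n)%:C%C : C).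
    apply/funext => N; rewrite rmorph_sum; apply: eq_big_nat => n /andP[n0' _].
    rewrite natpowN_real npow_natD // -(rmorph_nat (real_complex R)) -rmorphM.
    by congr (_%:C%C); rewrite mulrA mulrAC.
  exact: cvg_real_complex.
rewrite -rmorphM -rmorphB normc_def /= expr0n addr0 sqrtr_sqr -rmorphM.
by rewrite lecR.
Qed.

End Zeta.

Theorem corollary3p3 (R : realType) (K : fieldType) (S : comAlgType K)
    (Sn : nat -> {pred S}) (M : lmodType S) (Mn : nat -> {pred M}) (m : nat)
    (P : {poly rat}) (zetaM : Cplx R -> Cplx R) :
  standard_graded Sn ->
  graded_module Sn Mn ->
  fin_gen_module M ->
  krull_dim M m ->
  (1 <= m)%N ->
  hilbert_poly (hilbert_fun Mn) m P ->
  zeta_extension (hilbert_fun Mn) m zetaM ->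
  [/\ (multiplicity (hilbert_fun Mn) m)%:~R = hilbert_coef m P 0,
      hilbert_coef m P 0 = (m.-1)`!%:R * P`_m.-1
    & ratr ((m.-1)`!%:R * P`_m.-1) = (m.-1)`!%:R * residue zetaM m%:R].
Proof.
move=> _ _ _ _ m0 [sP [n0 _ HP]] [zmero zE].
have fN0 : m.-1`!%:R != 0 :> rat by rewrite pnatr_eq0 -lt0n fact_gt0.
(* The exact size of [P] makes [c 0] nonzero, which is the condition h(1) != 0 on the numerator. *)
have leadP : P`_m.-1 != 0.
  by rewrite -sP -lead_coefE lead_coef_eq0 -size_poly_eq0 sP -lt0n.
have [c Pc] : exists c : nat -> rat,
    P = \sum_(k < m) c k *: binom_poly (m.-1 - k)%N.
  by apply: binom_poly_span; rewrite sP.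
have c0E : c 0%N = m.-1`!%:R * P`_m.-1.
  by rewrite Pc coef_binom_poly_sum // mulrC divfK.
have eE := hilbert_coef0 m0 Pc.
split.
- rewrite eE; apply: (@multiplicity_eq _ _ n0) => //.
    by move=> n /HP; rewrite Pc.
  by rewrite c0E mulf_neq0.
- by rewrite eE.
rewrite rmorphM rmorph_nat; congr (_ * _).
have [||B B0 pole] :=
  @dirichlet_series_pole R (hilbert_fun Mn) (map_poly ratr P) m.-1 n0.
- by rewrite size_map_poly sP prednK.
- move=> n /HP Hn; rewrite -(rmorph_nat (ratr : {rmorphism rat -> R})) Hn.
  by rewrite -horner_map /= rmorph_nat.
rewrite (@residue_eq _ _ _ (ratr P`_m.-1) B) // => t t0.
have := pole t t0; rewrite prednK // coef_map /= (fmorph_rat (real_complex R)).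
(* The ray m + t with t > 0 lies in the half-plane where [zetaM] equals its series. *)
rewrite zE //.
move: t0; rewrite ltcE => /andP[_ t0].
by rewrite -(rmorph_nat (real_complex R)) raddfD /= ltrDl.
Qed.
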